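(* Consider the PM-SLP problem $\min_{\mathbf{x}_1,\dots,\mathbf{x}_N,\mathbf{c}} \sum_{i=1}^{N}\|\mathbf{x}_i\|^2+\mathcal{I}_{\mathbb{R}^{2K}_+}(\mathbf{c})$ subject to $-\sum_{i=1}^{N}\mathbf{A}_i\mathbf{x}_i+\mathbf{b}+\mathbf{c}=\mathbf{0}$, with augmented Lagrangian $\mathcal{L}_\rho(\mathbf{x},\mathbf{c},\boldsymbol{\lambda})=\sum_{i=1}^{N}\|\mathbf{x}_i\|^2+\mathcal{I}_{\mathbb{R}^{2K}_+}(\mathbf{c})+\boldsymbol{\lambda}^T(-\sum_{i=1}^{N}\mathbf{A}_i\mathbf{x}_i+\mathbf{b}+\mathbf{c})+\frac{\rho}{2}\|-\sum_{i=1}^{N}\mathbf{A}_i\mathbf{x}_i+\mathbf{b}+\mathbf{c}\|^2$. Let $\{\mathbf{u}^t\}$, with $\mathbf{u}^t=(\mathbf{x}^t_1,\dots,\mathbf{x}^t_N,\boldsymbol{\lambda}^t)$, be the sequence generated from an arbitrary initialization by the proximal Jacobian ADMM iterations $\mathbf{c}^{t+1}=\arg\min_{\mathbf{c}}\mathcal{L}_\rho(\mathbf{x}^t_1,\dots,\mathbf{x}^t_N,\mathbf{c},\boldsymbol{\lambda}^t)$, $\mathbf{x}^{t+1}_i=\arg\min_{\mathbf{x}_i}\mathcal{L}_\rho(\mathbf{x}^t_{\neq i},\mathbf{x}_i,\mathbf{c}^{t+1},\boldsymbol{\lambda}^t)+\frac{1}{2}\|\mathbf{x}_i-\mathbf{x}^t_i\|^2_{\mathbf{P}_i}$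 for all $i$ (in parallel), $\boldsymbol{\lambda}^{t+1}=\boldsymbol{\lambda}^t+\beta\rho(-\sum_{i=1}^{N}\mathbf{A}_i\mathbf{x}^{t+1}_i+\mathbf{b}+\mathbf{c}^{t+1})$. If there exist $\epsilon_i>0$ such that $\mathbf{P}_i\succeq\rho(\frac{1}{\epsilon_i}-1)\mathbf{A}^T_i\mathbf{A}_i$ for all $i$ and $\sum_{i=1}^N\epsilon_i\leq 2-\beta$, then $\{\mathbf{u}^t\}$ converges to a solution $\mathbf{u}^*$ of the PM-SLP problem.
   Context: Downlink MU-MISO with $N_t$ transmit antennas and $K$ single-antenna users, $\mathcal{M}$-PSK symbols. The real-valued transmit signal $\mathbf{x}\in\mathbb{R}^{2N_t}$ is partitioned into $N$ blocks $\mathbf{x}_i\in\mathbb{R}^{n_i}$ ($\sum_i n_i=2N_t$), and $\mathbf{A}_i\in\mathbb{R}^{2K\times n_i}$ are the corresponding column blocks of the stacked constructive-interference constraint matrix $\mathbf{A}$, so that the CI constraints read $\sum_i\mathbf{A}_i\mathbf{x}_i\succeq\mathbf{b}$ with $\mathbf{b}=[\sqrt{\gamma_1}\sigma_1\mathbf{1}^T,\dots,\sqrt{\gamma_K}\sigma_K\mathbf{1}^T]^T$; $\mathbf{c}\in\mathbb{R}^{2K}_+$ is a slack variable and $\mathcal{I}_{\mathbb{R}^{2K}_+}$ the indicator function of the nonnegative orthant. $\rho>0$ is the penalty parameter, $\beta>0$ a damping parameter, $\mathbf{P}_i$ symmetric positive semidefinite, and $\|\mathbf{z}\|^2_{\m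athbf{P}}=\mathbf{z}^T\mathbf{P}\mathbf{z}$.
   Formalization: The formal theorem adds the hypothesis that the PM-SLP problem is feasible (some x and c ≥ 0 satisfy the constraint); without it no solution need exist, e.g. A = 0 with b > 0, where λ^t diverges. *)

(* Defs.v *)
From HB Require Import structures.
From mathcomp Require Import all_boot all_order all_algebra.
From mathcomp Require Import all_classical all_reals all_analysis.
Set Implicit Arguments. Unset Strict Implicit. Unset Printing Implicit Defensive.
Import Order.TTheory GRing.Theory Num.Theory.
Import numFieldNormedType.Exports.
Local Open Scope ring_scope.

Section PMSLP.
Variable R : realType.

Definition sqnorm m (v : 'cV[R]_m) : R := (v^T *m v) 0 0.
Definition qform m (M : 'M[R]_m) (v : 'cV[R]_m) : R := (v^T *m M *m v) 0 0.
Definition psd m (M : 'M[R]_m) : Prop := forall v : 'cV[R]_m, 0 <= qform M v.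
Definition nonneg m (v : 'cV[R]_m) : Prop := forall j, 0 <= v j 0.

Variables (N K : nat) (n : 'I_N -> nat).

Definition blocks := forall i : 'I_N, 'cV[R]_(n i).

Definition upd (x : blocks) (i : 'I_N) (y : 'cV[R]_(n i)) : blocks :=
  fun j => match i =P j with
           | ReflectT e => eq_rect i (fun k => 'cV[R]_(n k)) y j e
           | ReflectF _ => x j
           end.

Variables (A : forall i : 'I_N, 'M[R]_(2 * K, n i)) (b : 'cV[R]_(2 * K)).

Definition residual (x : blocks) (c : 'cV[R]_(2 * K)) : 'cV[R]_(2 * K) :=
  - (\sum_(i < N) A i *m x i) + b + c.

Definition objective (x : blocks) : R := \sum_(i < N) sqnorm (x i).

(* Lagrangian; the indicator I_{R^{2K}_+}(c) is 0 on the domain c >= 0 and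
   +oo outside, which is handled by restricting c to nonneg c everywhere. *)
Definition lagr (x : blocks) (c l : 'cV[R]_(2 * K)) : R :=
  objective x + (l^T *m residual x c) 0 0.

Definition auglag (rho : R) (x : blocks) (c l : 'cV[R]_(2 * K)) : R :=
  lagr x c l + rho / 2 * sqnorm (residual x c).

Definition feasible : Prop :=
  exists (x : blocks) (c : 'cV[R]_(2 * K)), nonneg c /\ residual x c = 0.

Definition solution (xs : blocks) (ls : 'cV[R]_(2 * K)) : Prop :=
  exists cs : 'cV[R]_(2 * K), nonneg cs /\
    (forall l, lagr xs cs l <= lagr xs cs ls) /\
    (forall (x : blocks) (c : 'cV[R]_(2 * K)), nonneg c ->
        lagr xs cs ls <= lagr x c ls).

Definition c_step (rho : R) (xt : blocks) (lt cnext : 'cV[R]_(2 * K)) : Prop :=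
  nonneg cnext /\
  forall c, nonneg c -> auglag rho xt cnext lt <= auglag rho xt c lt.

Definition x_step (rho : R) (P : forall i : 'I_N, 'M[R]_(n i)) (i : 'I_N)
    (xt : blocks) (cnext lt : 'cV[R]_(2 * K)) (xi : 'cV[R]_(n i)) : Prop :=
  forall y : 'cV[R]_(n i),
    auglag rho (upd xt xi) cnext lt + 1 / 2 * qform (P i) (xi - xt i)
    <= auglag rho (upd xt y) cnext lt + 1 / 2 * qform (P i) (y - xt i).

End PMSLP.

(* Main.v *)
(* Let (xs, cs, ls) be a KKT point, e = x^(t+1) - xs, d = x^t - x^(t+1),
   r = residual at t+1, and G_i = P_i + rho A_i^T A_i.  Testing the optimality
   conditions of the three steps against the KKT conditions shows that the energy
   V_t = sum_i |x_i^t - xs_i|^2_(G_i) + |lam^t - ls|^2 / (beta rho) drops by at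
   least 4 |e|^2 + sum_i |d_i|^2_(G_i) + rho (2 - beta) |r|^2 - 2 rho <r, A d>.
   The last three terms are nonnegative by Young's inequality with weights eps_i,
   while the first one, due to the strong convexity of the objective, gives
   x^t -> xs even when the hypotheses on P_i and eps_i hold with equality.
   Then r -> 0, because 2 - beta >= sum_i eps_i > 0.  The multipliers are bounded,
   and the optimality conditions of the steps pass to the limit along a
   subsequence, so any cluster point li makes (xs, cs, li) a KKT point.  Its energy
   is nonincreasing and tends to 0 along the subsequence, whence lam^t -> li.
   A KKT point exists by applying Farkas' lemma to the variational inequality of
   the point of least norm in the feasible polyhedron. *)
Require Import Defs.
From HB Require Import structures.
From mathcomp Require Import all_boot all_order all_algebra.
From mathcomp Require Import all_classical all_reals all_analysis.
From mathcomp Require Import ring lra.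
Set Implicit Arguments. Unset Strict Implicit. Unset Printing Implicit Defensive.
Import Order.TTheory GRing.Theory Num.Theory.
Import numFieldNormedType.Exports.
Local Open Scope classical_set_scope.
Local Open Scope ring_scope.

(** * The Euclidean inner product and Farkas' lemma *)

Section Dot.
Variable R : realType.

Definition dot {m} (u v : 'cV[R]_m) : R := (u^T *m v) 0 0.

Lemma dotE m (u v : 'cV[R]_m) : dot u v = \sum_i u i 0 * v i 0.
Proof. by rewrite /dot mxE; apply: eq_bigr => i _; rewrite mxE. Qed.

Lemma dotC m (u v : 'cV[R]_m) : dot u v = dot v u.
Proof. by rewrite !dotE; apply: eq_bigr => i _; rewrite mulrC. Qed.

Lemma dotDr m (u v w : 'cV[R]_m) : dot u (v + w) = dot u v + dot u w.
Proof. by rewrite /dot mulmxDr mxE. Qed.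

Lemma dotZr m a (u v : 'cV[R]_m) : dot u (a *: v) = a * dot u v.
Proof. by rewrite /dot -scalemxAr mxE. Qed.

Lemma dotDl m (u v w : 'cV[R]_m) : dot (u + v) w = dot u w + dot v w.
Proof. by rewrite dotC dotDr !(dotC w). Qed.

Lemma dotZl m a (u v : 'cV[R]_m) : dot (a *: u) v = a * dot u v.
Proof. by rewrite dotC dotZr dotC. Qed.

Lemma dotNr m (u v : 'cV[R]_m) : dot u (- v) = - dot u v.
Proof. by rewrite -scaleN1r dotZr mulN1r. Qed.

Lemma dotNl m (u v : 'cV[R]_m) : dot (- u) v = - dot u v.
Proof. by rewrite dotC dotNr dotC. Qed.

Lemma dot0r m (u : 'cV[R]_m) : dot u 0 = 0.
Proof. by rewrite -(scale0r 0) dotZr mul0r. Qed.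

Lemma dot0l m (u : 'cV[R]_m) : dot 0 u = 0.
Proof. by rewrite dotC dot0r. Qed.

Definition dot_lin := (dotDl, dotDr, dotNl, dotNr, dotZl, dotZr).

Lemma dot_sumr m (I : Type) (s : seq I) (u : 'cV[R]_m) (F : I -> 'cV[R]_m) :
  dot u (\sum_(i <- s) F i) = \sum_(i <- s) dot u (F i).
Proof.
by elim: s => [|i s IHs]; rewrite ?big_nil ?dot0r // !big_cons dotDr IHs.
Qed.

Lemma dot_suml m (I : Type) (s : seq I) (u : 'cV[R]_m) (F : I -> 'cV[R]_m) :
  dot (\sum_(i <- s) F i) u = \sum_(i <- s) dot (F i) u.
Proof. by rewrite dotC dot_sumr; apply: eq_bigr => i _; rewrite dotC. Qed.

Lemma dot_mulmxl m k (A : 'M[R]_(m, k)) (u : 'cV[R]_k) (v : 'cV[R]_m) :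
  dot (A *m u) v = dot u (A^T *m v).
Proof. by rewrite /dot trmx_mul mulmxA. Qed.

Lemma dot_mulmxr m k (A : 'M[R]_(m, k)) (u : 'cV[R]_m) (v : 'cV[R]_k) :
  dot u (A *m v) = dot (A^T *m u) v.
Proof. by rewrite dotC dot_mulmxl dotC. Qed.

Lemma dot_col_mx m k (u u' : 'cV[R]_m) (v v' : 'cV[R]_k) :
  dot (col_mx u v) (col_mx u' v') = dot u u' + dot v v'.
Proof. by rewrite /dot tr_col_mx mul_row_col mxE. Qed.

Lemma dot_delta m (u : 'cV[R]_m) j : dot (delta_mx j 0) u = u j 0.
Proof. by rewrite /dot trmx_delta -rowE mxE. Qed.

Lemma sqnorm_dot m (u : 'cV[R]_m) : sqnorm u = dot u u.
Proof. by []. Qed.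

Lemma qform_dot m (M : 'M[R]_m) (u : 'cV[R]_m) : qform M u = dot u (M *m u).
Proof. by rewrite /qform /dot mulmxA. Qed.

Lemma sqnormE m (u : 'cV[R]_m) : sqnorm u = \sum_i u i 0 ^+ 2.
Proof. by rewrite sqnorm_dot dotE; apply: eq_bigr => i _; rewrite expr2. Qed.

Lemma sqnorm_ge0 m (u : 'cV[R]_m) : 0 <= sqnorm u.
Proof. by rewrite sqnormE sumr_ge0 // => i _; rewrite sqr_ge0. Qed.

Lemma entry_sqr_le m (u : 'cV[R]_m) i : u i 0 ^+ 2 <= sqnorm u.
Proof.
rewrite sqnormE (bigD1 i) //= lerDl sumr_ge0 // => j _.
by rewrite sqr_ge0.
Qed.

Lemma sqnorm_eq0 m (u : 'cV[R]_m) : sqnorm u <= 0 -> u = 0.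
Proof.
move=> u0; apply/colP => i; rewrite mxE.
have := le_trans (entry_sqr_le u i) u0.
by rewrite le_eqVlt ltNge sqr_ge0 orbF sqrf_eq0 => /eqP.
Qed.

Lemma dot_ge0_eq0 m (u : 'cV[R]_m) : (forall v, 0 <= dot u v) -> u = 0.
Proof.
by move=> h; apply: sqnorm_eq0; have := h (- u); rewrite dotNr oppr_ge0.
Qed.

Lemma nonneg_dot m (u v : 'cV[R]_m) : nonneg u -> nonneg v -> 0 <= dot u v.
Proof.
by move=> u0 v0; rewrite dotE sumr_ge0 // => i _; rewrite mulr_ge0.
Qed.

(** Expand the squared norm of [e *: u - v] and divide by [e]. *)
Lemma young_dot m (e : R) (u v : 'cV[R]_m) : 0 < e ->
  2 * dot u v <= e * sqnorm u + e^-1 * sqnorm v.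
Proof.
move=> e0; have := sqnorm_ge0 (e *: u - v).
rewrite !sqnorm_dot !dot_lin (dotC v u) => h.
rewrite -(ler_pM2l e0) mulrDr !mulrA mulfV ?gt_eqF // mul1r.
lra.
Qed.

(** Turns minimality along a segment into a first-order condition: every objective below is
    quadratic, so its increment along a segment is exactly [s * a + s ^+ 2 * q]. *)
Lemma slope_ge0 (a q : R) :
  (forall s, 0 < s <= 1 -> 0 <= s * a + s ^+ 2 * q) -> 0 <= a.
Proof.
move=> h; rewrite leNgt; apply/negP => a0.
have q1 : 0 < `|q| + 1 by rewrite ltr_wpDl.
have d0 : 0 < `|q| + 1 - a by lra.
(* This [s] lies in (0, 1] and gives a + s q <= - s (1 - a) < 0. *)
have := h (- a / (`|q| + 1 - a)).
rewrite divr_gt0 ?oppr_gt0 // ler_pdivrMr // mul1r.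
have -> : - a <= `|q| + 1 - a by lra.
move=> /(_ isT); set s := _ / _.
have s0 : 0 < s by rewrite divr_gt0 ?oppr_gt0.
have sd : s * (`|q| + 1 - a) = - a by rewrite /s divfK ?gt_eqF.
rewrite expr2 -mulrA -mulrDr pmulr_rge0 // => hq.
have := ler_wpM2l (ltW s0) (ler_norm q).
nra.
Qed.

(* Bartl's proof, by induction on the number of generators. *)
Lemma farkas m d (a : nat -> 'cV[R]_d) (g : 'cV[R]_d) :
  (forall w, (forall i, (i < m)%N -> 0 <= dot (a i) w) -> 0 <= dot g w) ->
  exists2 l : nat -> R, (forall i, 0 <= l i) & g = \sum_(i < m) l i *: a i.
Proof.
elim: m a g => [|m IHm] a g hg.
  exists (fun=> 0) => //; rewrite big_ord0; apply: dot_ge0_eq0 => v.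
  exact: hg.
have [h|] := pselect (forall w,
    (forall i, (i < m)%N -> 0 <= dot (a i) w) -> 0 <= dot g w).
  have [l l0 ->] := IHm _ _ h.
  exists (fun i => if (i < m)%N then l i else 0) => [i|]; first by case: ifP.
  rewrite big_ord_recr /= ltnn scale0r addr0.
  by apply: eq_bigr => i _; rewrite ltn_ord.
move=> /existsNP[w0 /not_implyP[aw0 /negP]]; rewrite -ltNge => gw0.
have amw0 : dot (a m) w0 < 0.
  rewrite ltNge; apply/negP => h; move: gw0; rewrite ltNge => /negP; apply.
  by apply: hg => i; rewrite ltnS leq_eqVlt => /predU1P[->|/aw0].
(* Project along [w0] onto the hyperplane [dot (a m) _ = 0]. *)
pose k (u : 'cV[R]_d) := dot u w0 / dot (a m) w0.
have kw (u w : 'cV[R]_d) : dot (u - k u *: a m) w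
    = dot u (w - (dot (a m) w / dot (a m) w0) *: w0).
  by rewrite /k !dot_lin; field; rewrite lt_eqF.
have [w hw|l l0 gE] := IHm (fun i => a i - k (a i) *: a m) (g - k g *: a m).
  rewrite kw; apply: hg => i; rewrite ltnS leq_eqVlt => /predU1P[->|im].
    by rewrite !dot_lin divfK ?lt_eqF // subrr.
  by rewrite -kw hw.
(* The coefficient of the last generator. It is nonnegative: [k g] is a quotient of two negative
   numbers, while each [k (a i)] is at most 0 because [dot (a i) w0] is nonnegative. *)
pose c := k g - \sum_(i < m) l i * k (a i).
have c0 : 0 <= c.
  rewrite subr_ge0; apply: (@le_trans _ _ 0).
    rewrite -oppr_ge0 -sumrN sumr_ge0 // => i _.
    rewrite -mulrN mulr_ge0 // -mulrN -invrN mulr_ge0 ?aw0 //.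
    by rewrite invr_ge0 oppr_ge0 ltW.
  by rewrite /k -mulrNN -invrN mulr_ge0 ?invr_ge0 ?oppr_ge0 // ltW.
exists (fun i => if (i < m)%N then l i else c) => [i|]; first by case: ifP.
rewrite big_ord_recr /= ltnn (eq_bigr (fun i : 'I_m => l i *: a i)); last first.
  by move=> i _; rewrite ltn_ord.
rewrite -[LHS](subrK (k g *: a m)) gE /=.
under eq_bigr do rewrite scalerBr scalerA.
by rewrite sumrB /c scalerBl scaler_suml -addrA (addrC (- _)).
Qed.

End Dot.

(** * Sequences of vectors *)

Section Limits.
Variable R : realType.

Lemma cvg_mxP m n (u : nat -> 'M[R]_(m, n)) (l : 'M[R]_(m, n)) :
  (forall i j, (fun t => u t i j) @ \oo --> l i j) <-> u @ \oo --> l.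
Proof.
split=> [h|ul i j]; last first.
  exact: (cvg_comp _ _ ul (differentiable_continuous (differentiable_coord _ i j))).
apply/cvg_mx_entourageP => E entE.
apply: filter_forall => i; apply: filter_forall => j.
by move/cvg_app_entourageP: (h i j) => /(_ _ entE); apply: filterS => t /= ?; rewrite inE.
Qed.

Lemma cvg_sumn (V : normedModType R) (I : finType) (u : I -> nat -> V) l :
  (forall i, u i @ \oo --> l i) ->
  (fun t => \sum_i u i t) @ \oo --> \sum_i l i.
Proof. by move=> ul; apply: cvg_big => //; exact: add_continuous. Qed.

Lemma cvg_mulmx m n k (A : 'M[R]_(m, n)) (u : nat -> 'M[R]_(n, k)) l :
  u @ \oo --> l -> (fun t => A *m u t) @ \oo --> A *m l.
Proof.
move=> /cvg_mxP ul; apply/cvg_mxP => i j.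
under eq_fun do rewrite mxE; rewrite mxE.
apply: cvg_sumn => j'.
by apply: cvgM => //; apply: cvg_cst.
Qed.

Lemma cvg_dot m (u v : nat -> 'cV[R]_m) lu lv :
  u @ \oo --> lu -> v @ \oo --> lv ->
  (fun t => dot (u t) (v t)) @ \oo --> dot lu lv.
Proof.
move=> /cvg_mxP ul /cvg_mxP vl; under eq_fun do rewrite dotE; rewrite dotE.
apply: cvg_sumn => j'.
by apply: cvgM.
Qed.

Lemma cvg_sqnorm0 m (u : nat -> 'cV[R]_m) l :
  (fun t => sqnorm (u t - l)) @ \oo --> (0 : R) -> u @ \oo --> l.
Proof.
move=> h; apply/cvg_mxP => i j; rewrite [j]ord1.
apply/cvgrPdist_lt => e e0.
have /cvgrPdist_lt/(_ (e ^+ 2)) := h; rewrite exprn_gt0 // => /(_ isT).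
apply: filterS => t; rewrite sub0r normrN ger0_norm ?sqnorm_ge0 // => ute.
rewrite distrC -(@ltr_pXn2r _ 2) ?nnegrE ?(ltW e0) // real_normK ?num_real //.
by apply: le_lt_trans ute; have := entry_sqr_le (u t - l) i; rewrite !mxE.
Qed.

(** A subsequence is encoded by an index map dominating the identity, possibly with repetitions;
    this already forces [s k] to infinity. *)
Lemma cvg_subseq (T : topologicalType) (u : nat -> T) (l : T) (s : nat -> nat) :
  (forall k, (k <= s k)%N) -> u @ \oo --> l -> (fun k => u (s k)) @ \oo --> l.
Proof.
move=> ks ul; apply: cvg_comp ul => A [N _ NA].
by exists N => // k /= Nk; apply: NA => /=; apply: leq_trans (ks k).
Qed.

Lemma bolzano_weierstrass m (u : nat -> 'cV[R]_m) (B : R) :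
  (forall t, sqnorm (u t) <= B) ->
  exists (l : 'cV[R]_m) (s : nat -> nat),
    (forall k, (k <= s k)%N) /\ (fun k => u (s k)) @ \oo --> l.
Proof.
move=> uB.
(* The bound [B + 1] dominates the square root of [B], so no root has to be taken. *)
have uB' t i : u t i 0 \in `[- (B + 1), B + 1].
  have := le_trans (entry_sqr_le (u t) i) (uB t).
  by rewrite in_itv /= => h; apply/andP; split; nra.
have cpt := @rV_compact R m (fun=> `[- (B + 1), B + 1]%classic)
  (fun=> @segment_compact _ _ _).
have [|v [_ vcl]] := cpt ((fun t => (u t)^T : 'rV[R]_m) @ \oo) _.
  by exists 0 => // t _ /= i; rewrite mxE; exact: uB'.
(* The cluster point meets each tail of the sequence within distance 1 / (k + 1). *)
have /choice[s hs] : forall k, exists t, (k <= t)%N /\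
    ball v (k.+1%:R^-1 : R) ((u t)^T).
  move=> k; have [||w [[t kt <-] wv]] := vcl
    [set w | exists2 t, (k <= t)%N & (u t)^T = w] (ball v (k.+1%:R^-1 : R)).
  - by exists k => // t /= kt; exists t.
  - by apply: nbhsx_ballx; rewrite invr_gt0.
  - by exists t.
exists v^T, s; split=> [k|]; first by case: (hs k).
apply/cvg_mxP => i j; rewrite [j]ord1; apply/cvgrPdist_lt => e e0.
near=> k; rewrite mxE; have [_ [_ /(_ 0 i)]] := hs k.
rewrite mxE => /lt_trans; apply.
near: k; exact: near_infty_natSinv_lt (PosNum e0).
Unshelve. all: by end_near. Qed.

End Limits.

(** * Existence of KKT points *)

Section MinNorm.
Variables (R : realType) (m d : nat) (A : 'M[R]_(m, d)) (b : 'cV[R]_m).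

(** A minimizing sequence has bounded norms, hence a cluster point; feasibility is a closed
    condition and the norm is continuous. *)
Lemma exists_min_norm (X0 : 'cV[R]_d) : nonneg (A *m X0 - b) ->
  exists2 X, nonneg (A *m X - b) &
    forall Y, nonneg (A *m Y - b) -> sqnorm X <= sqnorm Y.
Proof.
move=> X0f; pose S := [set sqnorm Y | Y in [set Y | nonneg (A *m Y - b)]].
have S0 : S !=set0 by exists (sqnorm X0), X0.
have Slb : lbound S 0 by move=> _ [Y _ <-]; exact: sqnorm_ge0.
have Sinf : has_inf S by split => //; exists 0.
have infS Y : nonneg (A *m Y - b) -> inf S <= sqnorm Y.
  by move=> Yf; apply: ge_inf; [exists 0|exists Y].
have /choice[u hu] : forall k, exists Y, nonneg (A *m Y - b) /\
    sqnorm Y < inf S + k.+1%:R^-1.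
  move=> k; have k0 : 0 < k.+1%:R^-1 :> R by rewrite invr_gt0.
  by have [_ [Y Yf <-] ltY] := inf_adherent k0 Sinf; exists Y.
have [|X [s [ks uX]]] := @bolzano_weierstrass _ _ u (inf S + 1).
  move=> t; have [_ /ltW/le_trans] := hu t; apply.
  by rewrite lerD2l invf_le1 // ler1n.
exists X => [j|Y /infS].
  have h : (fun k => (A *m u (s k) - b) j 0) @ \oo --> (A *m X - b) j 0.
    apply: (proj2 (cvg_mxP _ _)).
    by apply: cvgB; [exact: cvg_mulmx|exact: cvg_cst].
  apply: (ler_cvg_to (cvg_cst 0) h).
  by apply: nearW => k; case: (hu (s k)).
apply: le_trans; rewrite -[X in X <= _]/(dot X X).
have h := cvg_dot uX uX.
have h2 : (fun k => inf S + k.+1%:R^-1) @ \oo --> inf S + 0.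
  by apply: cvgD; [exact: cvg_cst|exact: cvg_harmonic].
rewrite addr0 in h2.
apply: (ler_cvg_to h (cvg_subseq ks h2)).
by apply: nearW => k; apply: ltW; case: (hu (s k)).
Qed.

Lemma min_norm_kkt (X0 : 'cV[R]_d) : nonneg (A *m X0 - b) ->
  exists X L, [/\ nonneg (A *m X - b), nonneg L, 2 *: X = A^T *m L &
    dot (A *m X - b) L = 0].
Proof.
move=> /exists_min_norm[X Xf Xmin].
(* The segment from X to Y stays feasible by convexity, and the squared norm along it has slope 2
   <X, Y - X> at X. *)
have vi Y : nonneg (A *m Y - b) -> 0 <= dot X (Y - X).
  move=> Yf; rewrite -(pmulr_rge0 _ (ltr0n R 2)).
  apply: (@slope_ge0 _ _ (sqnorm (Y - X))) => s /andP[s0 s1].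
  have /Xmin : nonneg (A *m (X + s *: (Y - X)) - b).
    move=> j; rewrite mulmxDr -scalemxAr mulmxBr.
    have -> : A *m X + s *: (A *m Y - A *m X) - b
        = (1 - s) *: (A *m X - b) + s *: (A *m Y - b).
      by apply/matrixP => i k; rewrite !mxE; ring.
    rewrite mxE addr_ge0 // mxE mulr_ge0 ?(Xf j) ?(Yf j) ?subr_ge0 //.
    exact: ltW.
  rewrite !sqnorm_dot !dot_lin (dotC Y X) => h.
  lra.
(* Farkas is applied to the homogenisation [(y, tau)] of the feasible
   polyhedron, so that no active set has to be singled out. *)
pose a i : 'cV[R]_(d + 1) := if insub i is Some j
  then col_mx (row j A)^T (- b j 0)%:M else delta_mx (rshift d 0) 0.
pose g : 'cV[R]_(d + 1) := col_mx X (- sqnorm X)%:M.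
have dot1 (u v : R) : dot (u%:M : 'cV_1) v%:M = u * v.
  by rewrite dotE big_ord1 !mxE !mulr1n.
have arow (j : 'I_m) y tau : dot (a j) (col_mx y tau%:M) = (A *m y) j 0 - b j 0 * tau.
  by rewrite /a valK dot_col_mx dot1 mulNr /dot trmxK -row_mul mxE.
have alast y tau : dot (a m) (col_mx y tau%:M) = tau.
  by rewrite /a insubF ?ltnn // dot_delta col_mxEd mxE mulr1n.
have [w hw|l l0 gE] := @farkas _ m.+1 _ a g.
  have := vsubmxK w; rewrite [dsubmx w]mx11_scalar.
  move: (usubmx w) (dsubmx w 0 0) => y tau /esym wE.
  have tau0 : 0 <= tau by rewrite -(alast y tau) -wE hw.
  have yf j : 0 <= (A *m y) j 0 - b j 0 * tau.
    by rewrite -arow -wE hw // ltnS ltnW.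
  rewrite wE dot_col_mx dot1 mulNr.
  (* If tau = 0, then y is a recession direction and X + y is feasible; otherwise y / tau is
     feasible. In both cases [vi] gives the sign. *)
  have [t0|t0] := eqVneq tau 0.
    rewrite t0 mulr0 subr0.
    have /vi : nonneg (A *m (X + y) - b).
      move=> j; rewrite mulmxDr addrAC mxE addr_ge0 ?(Xf j) //.
      by have := yf j; rewrite t0 mulr0 subr0.
    by rewrite addrAC subrr add0r.
  have tpos : 0 < tau by rewrite lt_def t0.
  have /vi : nonneg (A *m (tau^-1 *: y) - b).
    move=> j; rewrite -scalemxAr !mxE -(pmulr_rge0 _ tpos) mulrBr mulrA divff //.
    by rewrite mul1r [tau * _]mulrC; have := yf j; rewrite mxE.
  rewrite !dot_lin -(pmulr_rge0 _ tpos) mulrBr mulrA divff // mul1r.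
  by rewrite [tau * _]mulrC.
pose L : 'cV[R]_m := \col_j l j.
have Lf : nonneg L by move=> j; rewrite mxE.
(* The Farkas identity paired with (y, tau): tau = 0 yields stationarity, and (0, 1) yields
   complementarity. *)
have gP y tau : dot X y - sqnorm X * tau
    = dot L (A *m y) - dot L b * tau + l m * tau.
  have := congr1 (fun v => dot v (col_mx y tau%:M)) gE.
  rewrite dot_col_mx dot1 mulNr dot_suml big_ord_recr /= dotZl alast => ->.
  congr (_ + _); rewrite !dotE mulr_suml -sumrB; apply: eq_bigr => j _.
  by rewrite dotZl arow [L j 0]mxE; ring.
have XE : X = A^T *m L.
  apply/eqP; rewrite -subr_eq0; apply/eqP; apply: dot_ge0_eq0 => y.
  have := gP y 0; rewrite !mulr0 !subr0 addr0 => Xy.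
  by rewrite dotDl dotNl Xy dot_mulmxr subrr.
have sX : dot L (A *m X) = sqnorm X by rewrite dot_mulmxr -XE.
(* The factor 2 comes from the gradient 2 X of the squared norm. *)
exists X, (2 *: L); split=> //.
- by move=> j; rewrite mxE mulr_ge0.
- by rewrite -scalemxAr -XE.
apply/eqP; rewrite eq_le; apply/andP; split; last first.
  by rewrite nonneg_dot // => j; rewrite mxE mulr_ge0.
(* This reads |X|^2 = <L, b> - l_m with l_m >= 0, so <A X - b, L> <= 0. *)
have := gP 0 1; rewrite mulmx0 !dot0r (dotC (A *m X - b)) !dot_lin sX.
have := l0 m; lra.
Qed.

End MinNorm.

Section KKT.
Variables (R : realType) (N K : nat) (n : 'I_N -> nat).
Variables (A : forall i : 'I_N, 'M[R]_(2 * K, n i)) (b : 'cV[R]_(2 * K)).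

(** The last clause is the normal cone condition of the orthant at [cs], equivalent to [ls] being
    nonnegative and orthogonal to [cs]. As a variational inequality it matches the optimality
    condition of the c-step and passes to limits. *)
Definition kkt (xs : blocks R n) (cs ls : 'cV[R]_(2 * K)) : Prop :=
  [/\ nonneg cs, residual A b xs cs = 0,
      forall i, 2 *: xs i = (A i)^T *m ls &
      forall c, nonneg c -> 0 <= dot (c - cs) ls].

(** Stacking the blocks into one vector X and eliminating the slack as [B *m X - b] leaves a
    least-norm problem over a polyhedron. *)
Lemma exists_kkt : feasible A b -> exists xs cs ls, kkt xs cs ls.
Proof.
move=> [x0 [c0 [c0f r0]]].
pose B := \mxrow_i A i.
have BE (x : blocks R n) : B *m \mxcol_i x i = \sum_i A i *m x i.
  exact: mul_mxrow_mxcol.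
have [|X [L [Xf Lf XL comp]]] := @min_norm_kkt R _ _ B b (\mxcol_i x0 i).
  rewrite BE; suff -> : \sum_i A i *m x0 i - b = c0 by [].
  by move/eqP: r0; rewrite addr_eq0 => /eqP/(congr1 -%R); rewrite opprD !opprK.
exists (fun i => submxcol X i), (B *m X - b), L; split=> //.
- by rewrite /residual -BE submxcolK [- _ + b]addrC -opprB addNr.
- move=> i; rewrite -[(A i)^T](mxcolK (fun i => (A i)^T)) -tr_mxrow.
  by rewrite submxcol_mul -XL; apply/matrixP => j k; rewrite !mxE.
- move=> c cf; rewrite dotDl dotNl comp subr0; exact: nonneg_dot.
Qed.

(** The Lagrangian is constant in [l] where the residual vanishes. By stationarity it separates into
    a part minimized over x by completing squares and a linear part in c, handled by the normal cone
    condition. *)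
Lemma kkt_solution xs cs ls : kkt xs cs ls -> solution A b xs ls.
Proof.
move=> [csf r0 st comp]; exists cs; split=> //; split=> [l|x c cf].
  by rewrite /lagr r0 !mulmx0.
have cl : 0 <= dot c ls.
  have := comp (c + cs); rewrite addrK; apply=> j.
  by rewrite mxE addr_ge0.
have lag y e : lagr A b y e ls = \sum_i (sqnorm (y i) - 2 * dot (xs i) (y i))
    + (dot ls b + dot e ls).
  rewrite /lagr /objective -[(_ *m _) _ _]/(dot _ _) /residual !dot_lin.
  rewrite sumrB dot_sumr (dotC e) -!addrA; congr (_ + _).
  congr (- _ + _); apply: eq_bigr => i _.
  by rewrite dot_mulmxr -st dotZl.
have le_c : dot cs ls <= dot c ls.
  have := comp _ cf; rewrite dotDl dotNl subr_ge0 //.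
rewrite !lag; apply: lerD; last by rewrite lerD2l.
apply: ler_sum => i _.
have := sqnorm_ge0 (x i - xs i); rewrite !sqnorm_dot !dot_lin (dotC (xs i)).
lra.
Qed.

End KKT.

(** * Optimality conditions of the ADMM steps *)

Section Steps.
Variables (R : realType) (N K : nat) (n : 'I_N -> nat).
Variables (A : forall i : 'I_N, 'M[R]_(2 * K, n i)) (b : 'cV[R]_(2 * K)).
Variables (rho : R) (P : forall i : 'I_N, 'M[R]_(n i)).

Lemma sum_upd (V : zmodType) (F : forall j, 'cV[R]_(n j) -> V)
    (x : blocks R n) i (y : 'cV[R]_(n i)) :
  \sum_j F j (upd x y j) = \sum_j F j (x j) - F i (x i) + F i y.
Proof.
rewrite (bigD1 i) //= [\sum_j F j (x j)](bigD1 i) //= addrC [F i (x i) + _]addrC addrK.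
(* The cast in [upd] is along a proof of i = i, which [eq_axiomK] makes trivial. *)
congr (_ + F i _); last by rewrite /upd; case: eqP => // e; rewrite (eq_axiomK e).
apply: eq_bigr => j ji; rewrite /upd; case: eqP => // e.
by rewrite e eqxx in ji.
Qed.

Lemma residual_upd (x : blocks R n) i (y : 'cV[R]_(n i)) c :
  residual A b (upd x y) c = residual A b x c - A i *m (y - x i).
Proof.
rewrite /residual (sum_upd (fun j v => A j *m v)) mulmxBr.
by apply/matrixP => j k; rewrite !mxE; ring.
Qed.

Lemma auglagE x c l : auglag A b rho x c l = objective x
  + dot l (residual A b x c) + rho / 2 * dot (residual A b x c) (residual A b x c).
Proof. by []. Qed.

(** In c the augmented Lagrangian is quadratic, with gradient [l + rho *: residual A b x c'] at the
    minimizer. *)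
Lemma c_step_vi x l c' : c_step A b rho x l c' ->
  forall c, nonneg c -> 0 <= dot (c - c') (l + rho *: residual A b x c').
Proof.
move=> [c'f c'min] c cf; apply: (@slope_ge0 _ _ (rho / 2 * sqnorm (c - c'))).
move=> s /andP[s0 s1].
have /c'min : nonneg (c' + s *: (c - c')).
  move=> j; have -> : c' + s *: (c - c') = (1 - s) *: c' + s *: c.
    by apply/matrixP => i k; rewrite !mxE; ring.
  rewrite mxE addr_ge0 // mxE mulr_ge0 ?(c'f j) ?(cf j) ?subr_ge0 //.
  exact: ltW.
rewrite !auglagE.
have -> : residual A b x (c' + s *: (c - c')) = residual A b x c' + s *: (c - c').
  by rewrite /residual addrA.
rewrite sqnorm_dot.
move: (residual A b x c') (c - c') => r d.
rewrite !dot_lin (dotC d l) (dotC d r) => h; lra.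
Qed.

(** The other blocks keep their old values, so the residual in the gradient is the old one corrected
    by [A i *m (x i - xi)]. The symmetry of [P i] makes the proximal gradient equal to
    [P i *m (xi - x i)]. *)
Lemma x_step_opt i x c l xi : (P i)^T = P i ->
  x_step A b rho P x c l xi ->
  2 *: xi = (A i)^T *m (l + rho *: (residual A b x c + A i *m (x i - xi)))
            + P i *m (x i - xi).
Proof.
move=> Psym ximin; apply/eqP; rewrite -subr_eq0; apply/eqP.
apply: dot_ge0_eq0 => d.
have lin w e : dot (2 *: xi - ((A i)^T *m w + P i *m e)) d
    = 2 * dot xi d - dot w (A i *m d) - dot e (P i *m d).
  by rewrite dotDl dotNl dotDl dotZl !dot_mulmxl trmxK Psym opprD addrA.
(* The second-order coefficient of the objective along [d]. *)
pose q := sqnorm d + rho / 2 * sqnorm (A i *m d) + 1 / 2 * qform (P i) d.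
apply: (@slope_ge0 _ _ q) => s _; have := ximin (xi + s *: d).
rewrite lin !auglagE !residual_upd /objective.
rewrite !(sum_upd (fun j v => sqnorm v)) !qform_dot /q.
have -> : residual A b x c - A i *m (xi + s *: d - x i)
    = residual A b x c + A i *m (x i - xi) - s *: (A i *m d).
  rewrite !mulmxDr !mulmxN -scalemxAr.
  move: (residual _ _ _ _) (A i *m xi) (A i *m x i) (A i *m d) => r u v w.
  by apply/matrixP => j k; rewrite !mxE; ring.
have -> : residual A b x c - A i *m (xi - x i)
    = residual A b x c + A i *m (x i - xi).
  by rewrite -mulmxN opprB.
have -> : xi + s *: d - x i = s *: d - (x i - xi).
  by rewrite opprB addrCA addrA.
have -> : xi - x i = - (x i - xi) by rewrite opprB.
move: (x i - xi) => e; move: (residual A b x c + _) => r.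
rewrite !sqnorm_dot qform_dot !mulmxDr !mulmxN -!scalemxAr !dot_lin.
have -> : dot d (P i *m e) = dot e (P i *m d) by rewrite dot_mulmxr Psym dotC.
rewrite (dotC d xi) (dotC (A i *m d) r) => h.
lra.
Qed.

End Steps.

(** * Energy decrease *)

Section Energy.
Variables (R : realType) (N K : nat) (n : 'I_N -> nat).
Variables (A : forall i : 'I_N, 'M[R]_(2 * K, n i)) (b : 'cV[R]_(2 * K)).
Variables (rho beta : R) (P : forall i : 'I_N, 'M[R]_(n i)).
Hypotheses (rho0 : 0 < rho) (beta0 : 0 < beta).
Hypothesis Psym : forall i, (P i)^T = P i.

(** The squared seminorm of [v] weighted by G_i = P_i + rho A_i^T A_i. *)
Definition prox_form i (v : 'cV[R]_(n i)) : R :=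
  qform (P i) v + rho * sqnorm (A i *m v).

Definition energy (xs : blocks R n) (ls : 'cV[R]_(2 * K)) (x : blocks R n) l : R :=
  \sum_i prox_form (x i - xs i) + (beta * rho)^-1 * sqnorm (l - ls).

(** The part of the energy drop that remains beside the strong convexity term 4 |e|^2. *)
Definition dissipation (x x' : blocks R n) (r : 'cV[R]_(2 * K)) : R :=
  \sum_i prox_form (x i - x' i) + rho * (2 - beta) * sqnorm r
  - 2 * rho * dot r (\sum_i A i *m (x i - x' i)).

Lemma prox_formD i (u v : 'cV[R]_(n i)) : prox_form (u + v) = prox_form u
  + prox_form v + 2 * (dot u (P i *m v) + rho * dot (A i *m u) (A i *m v)).
Proof.
rewrite /prox_form !qform_dot !sqnorm_dot !mulmxDr !dot_lin.
have -> : dot v (P i *m u) = dot u (P i *m v) by rewrite dot_mulmxr Psym dotC.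
by rewrite (dotC (A i *m v)); ring.
Qed.

Lemma residualB (x x' : blocks R n) c c' : residual A b x c - residual A b x' c'
  = c - c' - \sum_i A i *m (x i - x' i).
Proof.
rewrite /residual; under [X in _ = _ - X]eq_bigr do rewrite mulmxBr.
rewrite sumrB; move: (\sum_i _) (\sum_i _) => u v.
by apply/matrixP => j k; rewrite !mxE; ring.
Qed.

Lemma energy_decrease xs cs ls (x x' : blocks R n) c' l l' :
  kkt A b xs cs ls ->
  c_step A b rho x l c' ->
  (forall i, x_step A b rho P x c' l (x' i)) ->
  l' = l + (beta * rho) *: residual A b x' c' ->
  energy xs ls x' l' + 4 * \sum_i sqnorm (x' i - xs i)
    + dissipation x x' (residual A b x' c') <= energy xs ls x l.
Proof.
move=> [csf rs st comp] cstep xstep ->.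
move rE: (residual A b x' c') => r.
move WE: (\sum_i A i *m (x i - x' i)) => W.
have rW : residual A b x c' = r - W.
  by rewrite -[LHS](subrK r) -{1}rE residualB subrr sub0r addrC WE.
move wE: (l - ls + rho *: (r - W)) => w.
(* Monotonicity of the normal cone: the c-step inequality tested at [cs] is added to the KKT
   inequality tested at [c']. *)
have c_le : dot (c' - cs) w <= 0.
  have h1 := c_step_vi cstep csf; have h2 := comp _ (proj1 cstep).
  rewrite rW in h1; move: h1 h2; rewrite -wE !dot_lin; lra.
(* The difference of the two stationarity equations, tested with [x' i - xs i]. *)
have xE i : 2 * sqnorm (x' i - xs i) = dot (A i *m (x' i - xs i)) w
    + dot (x' i - xs i) (P i *m (x i - x' i))
    + rho * dot (A i *m (x' i - xs i)) (A i *m (x i - x' i)).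
  have := x_step_opt (Psym i) (xstep i); rewrite rW => opt.
  rewrite sqnorm_dot -dotZr scalerBr opt st -wE.
  move: (x i - x' i) (x' i - xs i) => d e.
  by rewrite !dot_lin -!dot_mulmxl !dot_lin; ring.
have AE : \sum_i A i *m (x' i - xs i) = c' - cs - r.
  by have := residualB x' xs c' cs; rewrite rs subr0 rE => ->; rewrite subKr.
have sumE : 2 * \sum_i sqnorm (x' i - xs i) = dot (c' - cs - r) w
    + \sum_i (dot (x' i - xs i) (P i *m (x i - x' i))
    + rho * dot (A i *m (x' i - xs i)) (A i *m (x i - x' i))).
  rewrite mulr_sumr -AE dot_suml -big_split /=.
  by apply: eq_bigr => i _; rewrite xE addrA.
(* Polarization in the G_i-seminorm, with x - xs = (x' - xs) + (x - x'). *)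
have gE : \sum_i prox_form (x i - xs i) = \sum_i prox_form (x' i - xs i)
   + \sum_i prox_form (x i - x' i)
   + 2 * \sum_i (dot (x' i - xs i) (P i *m (x i - x' i))
    + rho * dot (A i *m (x' i - xs i)) (A i *m (x i - x' i))).
  rewrite mulr_sumr -!big_split /=; apply: eq_bigr => i _.
  by rewrite -prox_formD [in RHS]addrC addrA subrK.
have lE : (beta * rho)^-1 * sqnorm (l + (beta * rho) *: r - ls)
    = (beta * rho)^-1 * sqnorm (l - ls) + 2 * dot r (l - ls)
      + beta * rho * sqnorm r.
  rewrite addrAC; move: (l - ls) => e.
  rewrite !sqnorm_dot !dot_lin (dotC e r).
  by field; rewrite !gt_eqF.
rewrite /energy /dissipation WE lE gE.
move: sumE c_le; rewrite dotDl dotNl.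
(* The terms in [l - ls] cancel against those of [lE]; 2 rho from here minus beta rho from [lE]
   leaves the factor rho (2 - beta). *)
have -> : dot r w = dot r (l - ls) + rho * sqnorm r - rho * dot r W.
  by rewrite -wE sqnorm_dot !dot_lin; ring.
lra.
Qed.

Hypothesis Ppsd : forall i, psd (P i).

Lemma prox_form_ge0 i v : 0 <= @prox_form i v.
Proof. by rewrite addr_ge0 ?Ppsd // mulr_ge0 ?sqnorm_ge0 // ltW. Qed.

Lemma energy_ge0 xs ls x l : 0 <= energy xs ls x l.
Proof.
rewrite addr_ge0 //; first by rewrite sumr_ge0 // => i _; rewrite prox_form_ge0.
by rewrite mulr_ge0 ?sqnorm_ge0 // invr_ge0 ltW // mulr_gt0.
Qed.

Lemma sqnorm_le_energy xs ls x l :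
  sqnorm (l - ls) <= beta * rho * energy xs ls x l.
Proof.
have br0 : 0 < beta * rho by rewrite mulr_gt0.
rewrite /energy mulrDr mulrA divff ?gt_eqF // mul1r lerDr.
by rewrite mulr_ge0 ?(ltW br0) // sumr_ge0 // => i _; rewrite prox_form_ge0.
Qed.

Variable eps : 'I_N -> R.
Hypothesis eps0 : forall i, 0 < eps i.
Hypothesis Peps :
  forall i, psd (P i - (rho * ((eps i)^-1 - 1)) *: ((A i)^T *m A i)).
Hypothesis sum_eps : \sum_i eps i <= 2 - beta.

(** The hypothesis on P_i says that G_i dominates (rho / eps_i) A_i^T A_i, which absorbs one half of
    Young's bound on each cross term. The other halves add up to rho (sum of eps_i) |r|^2. *)
Lemma dissipation_ge0 x x' r : 0 <= dissipation x x' r.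
Proof.
rewrite /dissipation dot_sumr.
have h i : 2 * rho * dot r (A i *m (x i - x' i))
    <= prox_form (x i - x' i) + rho * eps i * sqnorm r.
  move: (x i - x' i) => v.
  have := @Peps i v; rewrite !qform_dot mulmxDl mulNmx -scalemxAl -mulmxA.
  rewrite dotDr dotNr dotZr -dot_mulmxl -sqnorm_dot /prox_form qform_dot.
  have := ler_wpM2l (ltW rho0) (young_dot r (A i *m v) (eps0 i)).
  nra.
have := ler_sum (index_enum 'I_N) (fun i _ => h i) (P := xpredT).
rewrite -mulr_sumr big_split /= -mulr_suml -mulr_sumr.
have := ler_wpM2l (mulr_ge0 (ltW rho0) (sqnorm_ge0 r)) sum_eps.
nra.
Qed.

End Energy.

(** * Convergence *)

Lemma squeeze0 (R : realType) (u v : nat -> R) :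
  (forall t, 0 <= u t <= v t) -> v @ \oo --> (0 : R) -> u @ \oo --> (0 : R).
Proof.
move=> uv; apply: squeeze_cvgr (cvg_cst 0).
exact: nearW.
Qed.

Lemma cvg_prox_form0 (R : realType) m d (A : 'M[R]_(m, d)) (P : 'M[R]_d) rho u :
  u @ \oo --> (0 : 'cV[R]_d) ->
  (fun t => qform P (u t) + rho * sqnorm (A *m u t)) @ \oo --> (0 : R).
Proof.
move=> u0; under eq_fun do rewrite qform_dot.
have h := cvg_dot u0 (cvg_mulmx (A := P) u0).
have h' := cvg_dot (cvg_mulmx (A := A) u0) (cvg_mulmx (A := A) u0).
have := cvgD h (cvgM (cvg_cst rho) h').
by rewrite !mulmx0 !dot0r mulr0 addr0; exact.
Qed.

Theorem theorem1 (R : realType) (N K : nat) (n : 'I_N -> nat)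
    (A : forall i : 'I_N, 'M[R]_(2 * K, n i)) (b : 'cV[R]_(2 * K))
    (rho beta : R) (P : forall i : 'I_N, 'M[R]_(n i))
    (x : nat -> blocks R n) (c lam : nat -> 'cV[R]_(2 * K)) :
  (0 < N)%N -> 0 < rho -> 0 < beta ->
  (forall i, (P i)^T = P i) -> (forall i, psd (P i)) ->
  feasible A b ->
  (forall t, c_step A b rho (x t) (lam t) (c t.+1)) ->
  (forall t i, x_step A b rho P (x t) (c t.+1) (lam t) (x t.+1 i)) ->
  (forall t, lam t.+1 =
     lam t + (beta * rho) *: residual A b (x t.+1) (c t.+1)) ->
  (exists eps : 'I_N -> R,
     (forall i, 0 < eps i) /\
     (forall i, psd (P i - (rho * ((eps i)^-1 - 1)) *: ((A i)^T *m A i))) /\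
     \sum_(i < N) eps i <= 2 - beta) ->
  exists (xs : blocks R n) (ls : 'cV[R]_(2 * K)),
    solution A b xs ls /\
    (forall i, (fun t => x t i) @ \oo --> xs i) /\
    lam @ \oo --> ls.
Proof.
move=> N0 rho0 beta0 Psym Ppsd feas cst xst lst [eps [eps0 [Peps sum_eps]]].
have beta2 : 0 < 2 - beta.
  apply: lt_le_trans sum_eps; rewrite (bigD1 (Ordinal N0)) //=.
  by rewrite ltr_pwDl // sumr_ge0 // => i _; exact: ltW.
pose V xs ls t := energy A rho beta P xs ls (x t) (lam t).
pose r t := residual A b (x t.+1) (c t.+1).
have decr xs cs ls t : kkt A b xs cs ls ->
    V xs ls t.+1 + 4 * \sum_i sqnorm (x t.+1 i - xs i)
    + dissipation A rho beta P (x t) (x t.+1) (r t) <= V xs ls t.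
  by move=> kk; apply: energy_decrease kk _ _ _.
have diss0 t : 0 <= dissipation A rho beta P (x t) (x t.+1) (r t).
  exact (dissipation_ge0 rho0 eps0 Peps sum_eps _ _ _).
have dist0 xs t : 0 <= \sum_i sqnorm (x t i - xs i).
  by rewrite sumr_ge0 // => i _; exact: sqnorm_ge0.
have Vdecr xs cs ls : kkt A b xs cs ls -> nonincreasing_seq (V xs ls).
  move=> kk; apply/nonincreasing_seqP => t.
  have := decr _ _ _ t kk; have := diss0 t; have := dist0 xs t.+1; lra.
have Vcvg xs cs ls : kkt A b xs cs ls -> cvgn (V xs ls).
  move=> /Vdecr Vd; apply: nonincreasing_is_cvgn => //.
  by exists 0 => _ [t _ <-]; exact: energy_ge0.
have [xs [cs [ls kk]]] := exists_kkt feas.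
have [csf rs st _] := kk.
(* The energy is nonincreasing and bounded below, so its decrements vanish, and with them all that
   they dominate. *)
have gap0 : (fun t => V xs ls t - V xs ls t.+1) @ \oo --> (0 : R).
  have Vl := Vcvg _ _ _ kk.
  have := cvgB Vl (cvg_subseq leqnSn Vl); by rewrite subrr; exact.
have xl i : (fun t => x t i) @ \oo --> xs i.
  rewrite -cvg_shiftS; apply: cvg_sqnorm0; apply: squeeze0 gap0 => t /=.
  rewrite sqnorm_ge0 /=.
  have hi : sqnorm (x t.+1 i - xs i) <= \sum_j sqnorm (x t.+1 j - xs j).
    by rewrite (bigD1 i) //= lerDl sumr_ge0 // => j _; exact: sqnorm_ge0.
  have := decr _ _ _ t kk; have := diss0 t; have := dist0 xs t.+1; lra.
have xl1 i : (fun t => x t.+1 i) @ \oo --> xs i.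
  exact: cvg_subseq leqnSn (xl i).
have dx i : (fun t => x t i - x t.+1 i) @ \oo --> (0 : 'cV[R]_(n i)).
  by have := cvgB (xl i) (xl1 i); rewrite subrr; exact.
pose W t := \sum_i A i *m (x t i - x t.+1 i).
have W0 : W @ \oo --> (0 : 'cV[R]_(2 * K)).
  have -> : 0 = \sum_i A i *m (0 : 'cV[R]_(n i)).
    by rewrite big1 // => i _; rewrite mulmx0.
  apply: cvg_sumn => i.
  exact: cvg_mulmx (dx i).
have r0 : r @ \oo --> (0 : 'cV[R]_(2 * K)).
  apply: cvg_sqnorm0; under eq_fun do rewrite subr0.
  (* Young with weight [s] spends half of the coefficient 2 - beta on the cross term. What is left
     reads rho s |r|^2 <= gap + (rho / s) |W|^2, and dividing by rho s gives the bound below. *)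
  pose s := (2 - beta) / 2; have s0 : 0 < s by rewrite divr_gt0.
  apply: (@squeeze0 _ _ (fun t => (rho * s)^-1 * (V xs ls t - V xs ls t.+1)
      + s^-1 ^+ 2 * sqnorm (W t))) => [t|]; last first.
    have WW := cvg_dot W0 W0.
    have := cvgD (cvgM (cvg_cst (rho * s)^-1) gap0) (cvgM (cvg_cst (s^-1 ^+ 2)) WW).
    by rewrite dot0l !mulr0 addr0; exact.
  rewrite sqnorm_ge0 /=.
  have prox0 : 0 <= \sum_i prox_form A rho P (x t i - x t.+1 i).
    by rewrite sumr_ge0 // => i _; exact: prox_form_ge0.
  have := decr _ _ _ t kk; have := dist0 xs t.+1.
  rewrite /dissipation -/(W t) => d0 dec.
  have y := ler_wpM2l (ltW rho0) (young_dot (r t) (W t) s0).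
  have rs0 : 0 < rho * s by rewrite mulr_gt0.
  rewrite -(ler_pM2l rs0) mulrDr mulVKf ?gt_eqF //.
  have -> : rho * s * (s^-1 ^+ 2 * sqnorm (W t)) = rho * (s^-1 * sqnorm (W t)).
    by field; rewrite gt_eqF.
  have sE : 2 - beta = 2 * s by rewrite /s mulrC divfK.
  rewrite sE in dec; nra.
have res0 : (fun t => residual A b (x t) (c t.+1)) @ \oo --> (0 : 'cV[R]_(2 * K)).
  have -> : (fun t => residual A b (x t) (c t.+1)) = (fun t => r t - W t).
    apply: funext => t; apply/eqP; rewrite -subr_eq0 opprB addrA [_ + W t]addrC.
    by rewrite -addrA residualB subrr sub0r subrr.
  by have := cvgB r0 W0; rewrite subr0; exact.
have cl : (fun t => c t.+1) @ \oo --> cs.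
  have -> : (fun t => c t.+1) = (fun t => r t + cs + \sum_i A i *m (x t.+1 i - xs i)).
    apply: funext => t; have := residualB A b (x t.+1) xs (c t.+1) cs.
    by rewrite rs subr0 -/(r t) => ->; rewrite addrAC subrK subrK.
  have Ax0 : (fun t => \sum_i A i *m (x t.+1 i - xs i)) @ \oo
      --> \sum_i A i *m (0 : 'cV[R]_(n i)).
    apply: cvg_sumn => i.
    apply: cvg_mulmx; have := cvgB (xl1 i) (cvg_cst (xs i)).
    by rewrite subrr; exact.
  have := cvgD (cvgD r0 (cvg_cst cs)) Ax0.
  rewrite big1 => [|i _]; last by rewrite mulmx0.
  by rewrite addr0 add0r; exact.
have [|l0 [s [ks l0P]]] := @bolzano_weierstrass _ _ (fun t => lam t - ls)
    (beta * rho * V xs ls 0%N).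
  move=> t; apply: le_trans (sqnorm_le_energy A rho0 beta0 Ppsd xs ls (x t) _) _.
  by rewrite ler_pM2l ?mulr_gt0 //; exact: (Vdecr _ _ _ kk 0%N t (leq0n t)).
pose li := l0 + ls.
have lamsl : (fun k => lam (s k)) @ \oo --> li.
  under eq_fun do rewrite -[lam _](subrK ls).
  exact: cvgD l0P (cvg_cst ls).
(* This vector drives the optimality conditions of both the c-step and the x-steps. *)
have forcing : (fun k => lam (s k) + rho *: residual A b (x (s k)) (c (s k).+1))
    @ \oo --> li + rho *: 0.
  exact: cvgD lamsl (cvgZr (cvg_subseq ks res0)).
rewrite scaler0 addr0 in forcing.
have kki : kkt A b xs cs li.
  split=> // [i|d d0].
    have di := cvg_subseq ks (dx i).
    have lhs : (fun k => 2 *: x (s k).+1 i) @ \oo --> 2 *: xs i.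
      exact: cvgZr (cvg_subseq ks (xl1 i)).
    have Adi : (fun k => rho *: (A i *m (x (s k) i - x (s k).+1 i))) @ \oo
        --> rho *: (A i *m (0 : 'cV[R]_(n i))).
      exact: cvgZr (cvg_mulmx (A := A i) di).
    have rhs : (fun k => 2 *: x (s k).+1 i) @ \oo
        --> (A i)^T *m (li + rho *: (A i *m 0)) + P i *m 0.
      under eq_fun do rewrite (x_step_opt (Psym i) (xst _ i)) scalerDr addrA.
      exact: cvgD (cvg_mulmx (cvgD forcing Adi)) (cvg_mulmx di).
    rewrite !mulmx0 scaler0 !addr0 in rhs.
    exact: norm_cvg_unique lhs rhs.
  have h : (fun k => dot (d - c (s k).+1)
      (lam (s k) + rho *: residual A b (x (s k)) (c (s k).+1))) @ \oo
      --> dot (d - cs) li.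
    exact: cvg_dot (cvgB (cvg_cst d) (cvg_subseq ks cl)) forcing.
  apply: (ler_cvg_to (cvg_cst 0) h); apply: nearW => k.
  exact: c_step_vi.
exists xs, li; split; first exact: kkt_solution kki.
split=> //; apply: cvg_sqnorm0.
(* The energy argument is restarted around [li]: this energy converges, and its limit is read off
   along [s]. *)
have Vi0 : V xs li @ \oo --> (0 : R).
  have Vl := Vcvg _ _ _ kki.
  suff Vs0 : (fun k => V xs li (s k)) @ \oo --> (0 : R).
    have lim0 : limn (V xs li) = 0 by exact: norm_cvg_unique (cvg_subseq ks Vl) Vs0.
    by rewrite lim0 in Vl.
  have prox_s : (fun k => \sum_i prox_form A rho P (x (s k) i - xs i)) @ \oo
      --> \sum_(i < N) (0 : R).
    apply: (cvg_sumn (u := fun i k => prox_form A rho P (x (s k) i - xs i))) => i.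
    have xi0 : (fun k => x (s k) i - xs i) @ \oo --> (0 : 'cV[R]_(n i)).
      have := cvgB (cvg_subseq ks (xl i)) (cvg_cst (xs i)).
      by rewrite subrr; exact.
    exact: (cvg_prox_form0 (A i) (P i) rho xi0).
  have dl : (fun k => lam (s k) - li) @ \oo --> li - li.
    exact: cvgB lamsl (cvg_cst li).
  have := cvgD prox_s (cvgM (cvg_cst (beta * rho)^-1) (cvg_dot dl dl)).
  by rewrite subrr dot0l mulr0 addr0 big1 //; exact.
have bV0 : (fun t => beta * rho * V xs li t) @ \oo --> beta * rho * 0.
  exact: cvgM (cvg_cst (beta * rho)) Vi0.
rewrite mulr0 in bV0; apply: squeeze0 bV0 => t.
by rewrite sqnorm_ge0 /=; exact: sqnorm_le_energy.
Qed.
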